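(* An LP$^{\text{MLN}}$ rule $w:r$ is valid (i.e. the one-rule program $\{w:r\}$ is p-strongly equivalent to the empty program) if and only if one of the following holds: (a) $r$ satisfies one of (TAUT) $h(r)\cap b^+(r)\neq\emptyset$, (CONTRA) $b^+(r)\cap b^-(r)\neq\emptyset$, (CONSTR3) $h(r)=b^+(r)=b^-(r)=\emptyset$; or (b) $r$ satisfies (CONSTR1) $h(r)=\emptyset$ or (CONSTR2) $h(r)\subseteq b^-(r)$, and $w=0$.
   Context: A literal is an atom or its classical negation; a set of literals is consistent if it does not contain an atom together with its negation. A ground ASP rule $r$ has the form $l_1\vee\dots\vee l_k\leftarrow l_{k+1},\dots,l_m,\ not\ l_{m+1},\dots,not\ l_n$; $h(r)=\{l_1,\dots,l_k\}$, $b^+(r)=\{l_{k+1},\dots,l_m\}$, $b^-(r)=\{l_{m+1},\dots,l_n\}$. A consistent set $X$ satisfies $r$ if $b^+(r)\subseteq X$ and $b^-(r)\cap X=\emptyset$ imply $h(r)\cap X\neq\emptyset$. The GL-reduct of an ASP program $P$ w.r.t. $X$ is $P^X=\{h(r)\leftarrow b^+(r)\mid r\in P,\ b^-(r)\cap X=\emptyset\}$; $X$ is a stable model of $P$ if $X$ is consistent, satisfies $P^X$, and no proper subset of $X$ satisfies $P^X$. An LP$^{\text{MLN}}$ program is a finite set of ground weighted rules $w:r$, with $w$ a real number or the symbol $\alpha$ (infinite weight). For a program $M$: $\overline{M}=\{r\mid w:r\in M\}$; $W(M)=\exp(\sum_{w:r\in M}w)$ (a formal expression in $\alpha$); $M_X=\{w:r\in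 M\mid X\text{ satisfies }r\}$; $X$ is a stable model of $M$ if $X$ is a stable model of $\overline{M_X}$; $SM(M)$ is the set of stable models; $W(M,X)=W(M_X)$ and $P(M,X)=\lim_{\alpha\to\infty}W(M,X)/\sum_{X'\in SM(M)}W(M,X')$. Programs $L,M$ are p-ordinarily equivalent if $SM(L)=SM(M)$ and $P(L,X)=P(M,X)$ for all stable models $X$; they are p-strongly equivalent if $L\cup N$ and $M\cup N$ are p-ordinarily equivalent for every LP$^{\text{MLN}}$ program $N$.
   Formalization: ''Only if'' is proved assuming b⁺(r) consistent and, when w=0, h(r)⊆b⁻(r) or some l in h(r)\b⁻(r) with b⁺(r)∪{l} consistent; otherwise it is false (c←a,¬a, or 0: a←¬a, is valid but meets none of the conditions). ''If'' holds for all rules. *)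

(* Defs.v *)
From HB Require Import structures.
From mathcomp Require Import all_boot all_order all_algebra finmap.
From mathcomp Require Import all_classical all_reals all_analysis.

Set Implicit Arguments.
Unset Strict Implicit.
Unset Printing Implicit Defensive.

Import Order.TTheory GRing.Theory Num.Theory.
Import numFieldNormedType.Exports.

Local Open Scope classical_set_scope.
Local Open Scope ring_scope.

(* [(a, true)] is the atom [a] and [(a, false)] its classical negation. *)
Definition literal (atom : choiceType) : choiceType := (atom * bool)%type.

Definition compl (atom : choiceType) (l : literal atom) : literal atom :=
  (l.1, ~~ l.2).

Definition consistent (atom : choiceType) (X : set (literal atom)) : Prop :=
  forall l, X l -> ~ X (compl l).

(* [Rule h bp bn] is the rule  \/ h <- bp, not bn. *)
Record rule (atom : choiceType) : Type := Rule {
  rhead : {fset literal atom};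
  rpos : {fset literal atom};
  rneg : {fset literal atom}
}.

Section RuleChoice.
Variable atom : choiceType.

Definition rule_code (r : rule atom) := (rhead r, rpos r, rneg r).
Definition rule_decode (t : {fset literal atom} * {fset literal atom} *
    {fset literal atom}) := Rule t.1.1 t.1.2 t.2.
Lemma rule_codeK : cancel rule_code rule_decode.
Proof. by case. Qed.

HB.instance Definition _ := Choice.copy (rule atom) (can_type rule_codeK).
End RuleChoice.

Definition asp_program (atom : choiceType) := {fset rule atom}.

Definition satisfies (atom : choiceType) (X : set (literal atom))
    (r : rule atom) : Prop :=
  [set` rpos r] `<=` X -> [set` rneg r] `&` X = set0 ->
  [set` rhead r] `&` X !=set0.

Definition satisfies_program (atom : choiceType) (X : set (literal atom))
    (P : asp_program atom) : Prop :=
  forall r, r \in P -> satisfies X r.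

Definition reduct (atom : choiceType) (P : asp_program atom)
    (X : set (literal atom)) : asp_program atom :=
  [fset Rule (rhead r) (rpos r) fset0 |
     r in P & `[< ([set` rneg r] `&` X = set0)%classic >]]%fset.

Definition asp_stable (atom : choiceType) (P : asp_program atom)
    (X : set (literal atom)) : Prop :=
  [/\ consistent X, satisfies_program X (reduct P X) &
      forall Y, Y `<` X -> ~ satisfies_program Y (reduct P X)].

(* A weight is a real number, [soft w], or the symbol alpha, [hard]. *)
Definition weight (R : realType) : choiceType := option R.
Definition soft (R : realType) (w : R) : weight R := Some w.
Definition hard (R : realType) : weight R := None.

Definition wrule (R : realType) (atom : choiceType) : choiceType :=
  (weight R * rule atom)%type.

Definition program (R : realType) (atom : choiceType) :=
  {fset wrule R atom}.

Definition unweighted (R : realType) (atom : choiceType)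
    (M : program R atom) : asp_program atom :=
  [fset wr.2 | wr in M]%fset.

Definition sat_part (R : realType) (atom : choiceType)
    (M : program R atom) (X : set (literal atom)) : program R atom :=
  [fset wr in M | `[< satisfies X wr.2 >]]%fset.

Definition SM (R : realType) (atom : choiceType) (M : program R atom) :
    set (set (literal atom)) :=
  [set X | asp_stable (unweighted (sat_part M X)) X].

(* Formal expressions in the symbol alpha are functions of a real [alpha]. *)
Definition weight_value (R : realType) (alpha : R) (w : weight R) : R :=
  if w is Some x then x else alpha.

Definition W (R : realType) (atom : choiceType) (M : program R atom)
    (alpha : R) : R :=
  expR (\sum_(wr <- M) weight_value alpha wr.1).

(* The sum is over a finite set: a stable model of the satisfied part of [M]
   only contains literals occurring in heads of rules of [M]. *)
Definition prob (R : realType) (atom : choiceType) (M : program R atom)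
    (X : set (literal atom)) : R :=
  lim ((W (sat_part M X) alpha /
        \sum_(X' \in SM M) W (sat_part M X') alpha) @[alpha --> +oo]).

Definition p_ordinarily_equivalent (R : realType) (atom : choiceType)
    (L M : program R atom) : Prop :=
  SM L = SM M /\ forall X, X \in SM L -> prob L X = prob M X.

Definition p_strongly_equivalent (R : realType) (atom : choiceType)
    (L M : program R atom) : Prop :=
  forall N : program R atom,
    p_ordinarily_equivalent (L `|` N)%fset (M `|` N)%fset.

Definition valid (R : realType) (atom : choiceType) (w : weight R)
    (r : rule atom) : Prop :=
  p_strongly_equivalent [fset ((w, r) : wrule R atom)]%fset fset0.

Definition TAUT (atom : choiceType) (r : rule atom) : Prop :=
  (rhead r `&` rpos r)%fset <> fset0.

Definition CONTRA (atom : choiceType) (r : rule atom) : Prop :=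
  (rpos r `&` rneg r)%fset <> fset0.

Definition CONSTR1 (atom : choiceType) (r : rule atom) : Prop :=
  rhead r = fset0.

Definition CONSTR2 (atom : choiceType) (r : rule atom) : Prop :=
  (rhead r `<=` rneg r)%fset.

Definition CONSTR3 (atom : choiceType) (r : rule atom) : Prop :=
  [/\ rhead r = fset0, rpos r = fset0 & rneg r = fset0].

(* A rule whose positive body is inconsistent is satisfied by every consistent
   set and is trivially valid.  So is a rule of weight 0 each of whose head
   literals outside the negative body is complementary to a literal of the
   positive body: like a constraint, it never supports a literal.  Apart from
   rules covered by the syntactic conditions above, [coherent] excludes only
   these two kinds of rules. *)
Definition coherent (R : realType) (atom : choiceType) (w : weight R)
    (r : rule atom) : Prop :=
  consistent [set` rpos r] /\
  (w = soft 0 -> CONSTR2 r \/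
    exists l, [/\ l \in rhead r, l \notin rneg r &
                  consistent ([set` rpos r] `|` [set l])]).

(* Main.v *)
(* Under (TAUT), (CONTRA) or (CONSTR1)-(CONSTR3), if [X] satisfies [r] and
   [Y `<=` X] then [Y] satisfies the reduct of [r] w.r.t. [X], so adding [r]
   does not change the stable models.  Their weights are multiplied by a common
   factor, which cancels in the probabilities: either every set satisfies [r],
   or none does, or [w = 0].
   Conversely, weight-0 facts over a finite set [A] make the consistent subsets
   of [A] equiprobable stable models.  If [r] satisfies none of (TAUT),
   (CONTRA), (CONSTR3), one such subset violates [r] and another one satisfies
   it; adding [w : r] multiplies the ratio of their probabilities by [exp w],
   hence [w = 0].  A weight-0 rule which can derive a new literal on top of its
   positive body creates a stable model. *)
Require Import Defs.
From mathcomp Require Import all_boot all_order all_algebra finmap.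
From mathcomp Require Import all_classical all_reals all_analysis.

Set Implicit Arguments.
Unset Strict Implicit.
Unset Printing Implicit Defensive.

Import Order.TTheory GRing.Theory Num.Theory.
Import numFieldNormedType.Exports.

Local Open Scope classical_set_scope.
Local Open Scope ring_scope.

(** * Reducts and stable models of weighted programs *)

Lemma satisfies_reductP (atom : choiceType) (P : asp_program atom)
    (X Y : set (literal atom)) :
  satisfies_program Y (reduct P X) <->
  forall r, r \in P -> [set` rneg r] `&` X = set0 ->
    [set` rpos r] `<=` Y -> [set` rhead r] `&` Y !=set0.
Proof.
split=> [satY r rP rX rY|satY r' /imfsetP[r /= /andP[rP /asboolP rX] ->]].
  have := satY (Rule (rhead r) (rpos r) fset0); apply => //=.
    apply/imfsetP; exists r => //=; rewrite inE/= rP/=; exact/asboolP.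
  by rewrite -subset0 => l [].
by move=> /= rY _; exact: satY.
Qed.

Lemma mem_sat_part (R : realType) (atom : choiceType) (M : program R atom)
    (X : set (literal atom)) wr :
  (wr \in sat_part M X) = (wr \in M) && `[< satisfies X wr.2 >].
Proof. by rewrite !inE. Qed.

(* The rules of [sat_part M X] are satisfied by [X], hence so is the reduct:
   only minimality and consistency remain in the definition of [SM M]. *)
Lemma SMP (R : realType) (atom : choiceType) (M : program R atom)
    (X : set (literal atom)) :
  SM M X <-> consistent X /\
    forall Y, Y `<=` X ->
      (forall wr, wr \in M -> satisfies X wr.2 ->
         [set` rneg wr.2] `&` X = set0 -> [set` rpos wr.2] `<=` Y ->
         [set` rhead wr.2] `&` Y !=set0) -> X `<=` Y.
Proof.
have modelP Y : satisfies_program Y (reduct (unweighted (sat_part M X)) X) <->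
    forall wr, wr \in M -> satisfies X wr.2 ->
      [set` rneg wr.2] `&` X = set0 -> [set` rpos wr.2] `<=` Y ->
      [set` rhead wr.2] `&` Y !=set0.
  rewrite satisfies_reductP; split=> [satY wr wrM wrX|satY r].
    apply: satY; apply/imfsetP; exists wr => //=.
    by rewrite mem_sat_part wrM; exact/asboolP.
  by case/imfsetP => wr /=; rewrite mem_sat_part => /andP[wrM /asboolP wrX] ->;
    exact: satY.
split=> [[cX _ minX]|[cX minX]].
  split=> // Y YX /modelP satY; apply: contrapT => nXY.
  by apply: (minX Y).
split=> //.
  by apply/modelP => wr _ wrX rX pX; exact: wrX.
by move=> Y [YX nXY] /modelP satY; apply: nXY; exact: minX.
Qed.

(** * Sufficiency: adding an inert rule *)

Lemma sat_part_fset1U (R : realType) (atom : choiceType) (w : weight R)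
    (r : rule atom) (N : program R atom) (X : set (literal atom)) :
  sat_part ([fset ((w, r) : wrule R atom)] `|` N)%fset X =
  (if `[< satisfies X r >] then [fset ((w, r) : wrule R atom)] `|` sat_part N X
   else sat_part N X)%fset.
Proof.
apply/fsetP => wr; case: asboolP => rX; rewrite !(mem_sat_part, inE)/=.
  case: eqP => [->/=|//]; exact/asboolP.
case: eqP => [->/=|//]; case: asboolP => //; by rewrite andbF.
Qed.

Lemma W_sat_part_fset1U (R : realType) (atom : choiceType) (w : weight R)
    (r : rule atom) (N : program R atom) (X : set (literal atom)) (a : R) :
  (w, r) \notin N ->
  W (sat_part ([fset ((w, r) : wrule R atom)] `|` N)%fset X) a =
  (if `[< satisfies X r >] then expR (weight_value a w) else 1) *
    W (sat_part N X) a.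
Proof.
move=> wrN; rewrite sat_part_fset1U; case: asboolP => rX; last by rewrite mul1r.
by rewrite /W big_fsetU1 ?expRD//= mem_sat_part (negbTE wrN).
Qed.

Lemma eq_lim_pinfty (R : realType) (f g : R -> R) :
  f =1 g -> lim (f a @[a --> +oo]) = lim (g a @[a --> +oo]).
Proof. by move=> /funext ->. Qed.

(** The factor may depend on [alpha] but not on the stable model, so it cancels in each quotient
    before the limit is taken. *)
Lemma p_ordinarily_equivalent_scale (R : realType) (atom : choiceType)
    (L M : program R atom) (c : R -> R) :
  (forall a, c a != 0) -> SM L = SM M ->
  (forall X a, SM M X -> W (sat_part L X) a = c a * W (sat_part M X) a) ->
  p_ordinarily_equivalent L M.
Proof.
move=> c0 eSM eW; split=> [|X]; first exact: eSM.
rewrite eSM => /set_mem XM.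
rewrite /prob eSM; apply: eq_lim_pinfty => a.
rewrite (eW _ _ XM) (eq_fsbigr (fun X' => c a * W (sat_part M X') a)).
  by rewrite -mulr_fsumr -mulf_div divff ?mul1r.
by move=> X' /set_mem; exact: eW.
Qed.

(** By [SMP], a rule acts only through the subsets [Y] that it rules out in the minimality test;
    [inert] says that [r] rules out none. *)
Lemma SM_add_inert (R : realType) (atom : choiceType) (w : weight R)
    (r : rule atom) (N : program R atom) :
  (forall X Y, Y `<=` X -> satisfies X r -> [set` rneg r] `&` X = set0 ->
     [set` rpos r] `<=` Y -> [set` rhead r] `&` Y !=set0) ->
  SM ([fset ((w, r) : wrule R atom)] `|` N)%fset = SM N.
Proof.
move=> inert; apply/seteqP; split=> X /SMP[cX minX]; apply/SMP;
    split=> // Y YX satY; apply: minX => // wr wrN; last first.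
  by apply: satY; rewrite !inE wrN orbT.
move: wrN; rewrite !inE => /orP[/eqP->/=|wrN]; last exact: satY.
exact: inert.
Qed.

Lemma valid_inert (R : realType) (atom : choiceType) (w : weight R)
    (r : rule atom) :
  (forall X Y, Y `<=` X -> satisfies X r -> [set` rneg r] `&` X = set0 ->
     [set` rpos r] `<=` Y -> [set` rhead r] `&` Y !=set0) ->
  [\/ w = soft 0, forall X, satisfies X r | forall X, ~ satisfies X r] ->
  valid w r.
Proof.
move=> inert satr N; rewrite fset0U.
(* Programs are sets: if [N] already contains the rule, the union is [N] and the rule is not counted
   twice. *)
have [wrN|wrN] := boolP ((w, r) \in N).
  suff -> : ([fset (w, r)] `|` N)%fset = N by [].
  by apply/fsetUidPr; rewrite fsub1set.
have eSM := SM_add_inert w N inert.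
case: satr => [w0|satr|nsatr].
- apply: (p_ordinarily_equivalent_scale (c := fun=> 1)) => // X a _.
  by rewrite W_sat_part_fset1U// w0/= expR0 if_same.
- apply: (p_ordinarily_equivalent_scale
    (c := fun a => expR (weight_value a w))) => // [a|X a _].
    exact: lt0r_neq0 (expR_gt0 _).
  by rewrite W_sat_part_fset1U// asboolT.
- apply: (p_ordinarily_equivalent_scale (c := fun=> 1)) => // X a _.
  by rewrite W_sat_part_fset1U// asboolF.
Qed.

(** * Programs of weight-0 facts *)

Definition facts (R : realType) (atom : choiceType)
    (A : {fset literal atom}) : program R atom :=
  [fset ((soft 0, Rule [fset l] fset0 fset0) : wrule R atom) | l in A]%fset.

Lemma satisfies_fact (atom : choiceType) (X : set (literal atom)) l :
  satisfies X (Rule [fset l] fset0 fset0)%fset <-> X l.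
Proof.
rewrite /satisfies/=; split=> [|Xl _ _]; last by exists l; rewrite /= inE.
case=> //; first by rewrite -subset0 => ? [].
by move=> ? [/= /[!inE] /eqP->].
Qed.

(** A fact violated by [X] is dropped by [sat_part], so each weighted fact acts as a free choice of
    its literal. *)
Lemma SM_facts (R : realType) (atom : choiceType) (A : {fset literal atom}) :
  SM (facts R A) = [set X | consistent X /\ X `<=` [set` A]].
Proof.
apply/seteqP; split=> X; last first.
  move=> [cX XA]; apply/SMP; split=> // Y YX satY l Xl.
  have [||||l' []] := satY (soft 0, Rule [fset l] fset0 fset0)%fset.
  - by apply/imfsetP; exists l => //; exact: XA.
  - exact/satisfies_fact.
  - by rewrite -subset0 => ? [].
  - by [].
  - by rewrite /= inE => /eqP ->.
move=> /SMP[cX minX]; split=> //.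
(* The facts that hold in [X] also hold in its intersection with [A], so minimality puts [X] inside
   [A]. *)
apply: subset_trans (minX (X `&` [set` A]) _ _) _; first exact: subIsetl.
  move=> _ /imfsetP[l /= lA ->] /satisfies_fact Xl _ _.
  by exists l; rewrite /= inE.
exact: subIsetr.
Qed.

(** A sum of nonzero terms over an infinite set takes the default value 0; finiteness gives the
    lower bounds on normalizing sums below. *)
Lemma finite_SM_facts (R : realType) (atom : choiceType)
    (A : {fset literal atom}) : finite_set (SM (facts R A)).
Proof.
apply: (@sub_finite_set _ _
  ((fun B : {fset literal atom} => [set` B]) @` [set` fpowerset A])).
  rewrite SM_facts => X [_ XA]; exists [fset l in A | l \in X]%fset.
    by rewrite /= fpowersetE; apply/fsubsetP => l; rewrite !inE => /andP[].
  apply/seteqP; split=> l /=; rewrite !inE/=.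
    by case/andP=> _; rewrite inE.
  by move=> Xl; rewrite (XA _ Xl) mem_set.
exact/finite_image/finite_fset.
Qed.

Lemma W_facts (R : realType) (atom : choiceType) (A : {fset literal atom})
    (X : set (literal atom)) (a : R) : W (sat_part (facts R A) X) a = 1.
Proof.
rewrite /W big1_seq ?expR0// => wr /=.
by rewrite mem_sat_part => /andP[/imfsetP[l _ ->]].
Qed.

Lemma prob_facts (R : realType) (atom : choiceType) (A : {fset literal atom})
    (X : set (literal atom)) :
  prob (facts R A) X = (\sum_(X' \in SM (facts R A)) (1 : R))^-1.
Proof.
set c := _^-1; transitivity (lim (c @[_ --> (+oo : set_system R)])).
  apply: eq_lim_pinfty => a; rewrite W_facts div1r; congr (_^-1).
  by apply: eq_fsbigr => X' _; rewrite W_facts.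
exact: norm_lim_cst.
Qed.

(** * Necessity: the weight and the head of a valid rule *)

Lemma le_fsumr1 (R : realDomainType) (I : choiceType) (P : set I) (F : I -> R)
    (i : I) :
  finite_set P -> P i -> (forall j, P j -> 0 <= F j) ->
  F i <= \sum_(j \in P) F j.
Proof.
move=> finP Pi F0; rewrite (fsbigD1 i)//= lerDl.
by apply: fsumr_ge0 => j [/F0].
Qed.

(** Over the facts on [A], validity forces [X0] and [X1] to be equiprobable, while their weights are
    1 and the exponential of [w]. *)
Lemma valid_weight0 (R : realType) (atom : choiceType) (w : weight R)
    (r : rule atom) (A : {fset literal atom}) (X0 X1 : set (literal atom)) :
  valid w r -> consistent X0 -> consistent X1 ->
  X0 `<=` [set` A] -> X1 `<=` [set` A] ->
  ~ satisfies X0 r -> satisfies X1 r -> w = soft 0.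
Proof.
(* Assuming [w] nonzero ensures that the rule is not itself one of the facts. *)
move=> vwr cX0 cX1 X0A X1A nrX0 rX1; apply: contrapT => w0.
have wrN : (w, r) \notin facts R A.
  by apply/negP => /imfsetP[l _ [] /w0].
have {vwr} := vwr (facts R A); rewrite fset0U.
set L := (_ `|` _)%fset => -[eSM eP].
have WL X a : W (sat_part L X) a =
    if `[< satisfies X r >] then expR (weight_value a w) else 1.
  by rewrite W_sat_part_fset1U// W_facts mulr1.
clearbody L.
have SX0 : SM L X0 by rewrite eSM SM_facts.
have SX1 : SM L X1 by rewrite eSM SM_facts.
have finL : finite_set (SM L) by rewrite eSM; exact: finite_SM_facts.
pose Z a := \sum_(X \in SM L) W (sat_part L X) a.
have W_ge0 X a : 0 <= W (sat_part L X) a by exact: expR_ge0.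
have Z_ge0 a : 1 <= Z a.
  have -> : 1 = W (sat_part L X0) a by rewrite WL asboolF.
  by rewrite /Z; apply: (le_fsumr1 (F := fun X => W (sat_part L X) a)).
have P0 : prob L X0 = lim ((Z a)^-1 @[a --> +oo]).
  by rewrite /prob; under eq_fun do rewrite {1}WL asboolF// div1r.
have P1 : prob L X1 = lim (expR (weight_value a w) / Z a @[a --> +oo]).
  by rewrite /prob; under eq_fun do rewrite {1}WL asboolT//.
have P01 : prob L X0 = prob L X1.
  by rewrite (eP _ (mem_set SX0)) (eP _ (mem_set SX1)) !prob_facts.
have P0E : prob L X0 = (\sum_(X \in SM (facts R A)) (1 : R))^-1.
  by rewrite (eP _ (mem_set SX0)) prob_facts.
have S_ge1 : 1 <= \sum_(X \in SM (facts R A)) (1 : R).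
  by rewrite -eSM; exact: (le_fsumr1 (F := fun=> 1) finL SX0).
(* For a hard rule, [X1] contributes [expR a] to [Z a], so the probability of [X0] is squeezed to 0,
   yet it is the inverse of a finite sum. *)
case ew : w w0 => [x|] w0; last first.
  have /eqP : prob L X0 = 0.
    rewrite P0; apply: cvg_lim => //.
    apply: (squeeze_cvgr (f := fun=> 0) (h := fun a => expR (- a))).
    - apply: nearW => a; rewrite invr_ge0 (le_trans ler01)//= expRN.
      rewrite lef_pV2 ?posrE ?expR_gt0 ?(lt_le_trans ltr01)//.
      have -> : expR a = W (sat_part L X1) a by rewrite WL asboolT// ew.
      exact: (le_fsumr1 (F := fun X => W (sat_part L X) a)).
    - exact: cvg_cst.
    - exact: cvgr_expR.
  by rewrite P0E invr_eq0 gt_eqF// (lt_le_trans ltr01).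
(* With a real weight nothing depends on [alpha], so both limits are limits of constants. *)
have Zcst a : Z a = Z 0 by apply: eq_fsbigr => X _; rewrite !WL ew.
have Z_neq0 : Z 0 != 0 by rewrite gt_eqF// (lt_le_trans ltr01).
have : (Z 0)^-1 = expR x / Z 0.
  transitivity (prob L X0); [symmetry; rewrite P0|rewrite P01 P1].
    rewrite (@eq_lim_pinfty _ _ (fun=> (Z 0)^-1)) => [|a]; last by rewrite Zcst.
    exact: norm_lim_cst.
  rewrite (@eq_lim_pinfty _ _ (fun=> expR x / Z 0)) => [|a].
    exact: norm_lim_cst.
  by rewrite Zcst ew.
rewrite -[LHS]mul1r => /(mulIf (invr_neq0 Z_neq0)).
by rewrite -expR0 => /expR_inj x0; apply: w0; rewrite -x0.
Qed.

Lemma consistent1 (atom : choiceType) (l : literal atom) : consistent [set l].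
Proof. by move=> _ -> /= /(congr1 snd) /=; case: l.2. Qed.

(** The positive body itself violates [r]. Removing one of its literals yields a set satisfying [r];
    if it is empty, a singleton from the head or the negative body does. *)
Lemma valid_weight_eq0 (R : realType) (atom : choiceType) (w : weight R)
    (r : rule atom) :
  consistent [set` rpos r] -> ~ TAUT r -> ~ CONTRA r -> ~ CONSTR3 r ->
  valid w r -> w = soft 0.
Proof.
move=> cpos /contrapT nT /contrapT nC nC3 vwr.
have nsat : ~ satisfies [set` rpos r] r.
  case=> // [|l []/= hl pl].
    rewrite -subset0 => l []/= nl pl.
    by move/fsetP: nC => /(_ l); rewrite !inE nl pl.
  by move/fsetP: nT => /(_ l); rewrite !inE hl pl.
have [p0|[l lp]] := fset_0Vmem (rpos r); last first.
  have sub : [set` rpos r] `\ l `<=` [set` rpos r] by exact: subDsetl.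
  apply: (valid_weight0 vwr cpos _ _ sub nsat) => //.
    by move=> l' /sub/cpos + /sub.
  by move=> /(_ _ lp)[/= _] /(_ erefl).
have [l lhn] : exists l, l \in (rhead r `|` rneg r)%fset.
  have [hn0|[l lhn]] := fset_0Vmem (rhead r `|` rneg r)%fset; last by exists l.
  case: nC3; split=> //; apply/eqP; rewrite -fsubset0 -hn0.
    exact: fsubsetUl.
  exact: fsubsetUr.
apply: (valid_weight0 (A := [fset l]%fset) vwr cpos (consistent1 (l := l)) _ _
    nsat).
- by rewrite p0.
- by move=> _ ->; rewrite /= inE.
move=> _ nl0; exists l; split=> //=; move: lhn; rewrite inE => /orP[//|nl].
by have : ([set` rneg r] `&` [set l]) l by []; rewrite nl0.
Qed.

(* Over the facts [rpos r], the rule derives [l] on top of its body. *)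
Lemma not_valid_support (R : realType) (atom : choiceType) (w : weight R)
    (r : rule atom) l :
  ~ TAUT r -> ~ CONTRA r -> l \in rhead r -> l \notin rneg r ->
  consistent ([set` rpos r] `|` [set l]) -> ~ valid w r.
Proof.
move=> /contrapT nT /contrapT nC hl nl cX /(_ (facts R (rpos r))).
rewrite fset0U => -[eSM _].
(* So the body extended by [l] is not stable for the facts alone; it remains to show that it is
   stable once [r] is added. *)
have nlp : l \notin rpos r.
  by apply/negP => pl; move/fsetP: nT => /(_ l); rewrite !inE hl pl.
suff : SM (facts R (rpos r)) ([set` rpos r] `|` [set l]).
  rewrite SM_facts => -[_ /(_ l)]; rewrite /= (negbTE nlp) => /(_ _) Xl.
  by have : false by apply: Xl; right.
rewrite -eSM; apply/SMP; split=> // Y YX satY.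
(* The facts force the whole positive body into [Y], and then [r] forces a head literal into [Y]. *)
have pY : [set` rpos r] `<=` Y.
  move=> l' pl'; have [||||_ [/= /[!inE] /eqP->]//] :=
    satY (soft 0, Rule [fset l'] fset0 fset0)%fset.
  - by rewrite inE; apply/orP; right; apply/imfsetP; exists l'.
  - by apply/satisfies_fact; left.
  - by rewrite -subset0 => ? [].
  - by [].
have [||||l' [/= hl' Yl']] := satY (w, r).
- by rewrite !inE eqxx.
- by move=> _ _; exists l; split=> //=; right.
- rewrite -subset0 => l' [/= nl' [pl'|ll']].
    by move/fsetP: nC => /(_ l'); rewrite !inE nl' pl'.
  by move: nl; rewrite -ll' nl'.
- exact: pY.
move=> _ [/pY//|->].
(* Failure of (TAUT) keeps this head literal out of the positive body, so it is [l]. *)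
have [pl'|<-//] := YX _ Yl'.
by move/fsetP: nT => /(_ l'); rewrite !inE hl' pl'.
Qed.

(** * Characterization of valid rules *)

Theorem theorem3 (R : realType) (atom : choiceType) (w : weight R)
    (r : rule atom) :
  let cond := (TAUT r \/ CONTRA r \/ CONSTR3 r) \/
              ((CONSTR1 r \/ CONSTR2 r) /\ w = soft 0) in
  (coherent w r -> (valid w r <-> cond)) /\ (cond -> valid w r).
Proof.
move=> cond.
have suf : cond -> valid w r.
  move=> [[/eqP/fset0Pn[l]|[/eqP/fset0Pn[l]|[h0 p0 n0]]]|[hr w0]].
  - rewrite inE => /andP[hl pl]; apply: valid_inert.
      by move=> X Y _ _ _ pY; exists l; split=> //; exact: pY.
    by apply: Or32 => X pX _; exists l; split=> //; exact: pX.
  - rewrite inE => /andP[pl nl].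
    have nX X : [set` rpos r] `<=` X -> [set` rneg r] `&` X <> set0.
      move=> pX nX0; have : ([set` rneg r] `&` X) l by split=> //; exact: pX.
      by rewrite nX0.
    apply: valid_inert; last by apply: Or32 => X /nX.
    by move=> X Y YX _ nX0 pY; case: (nX X) => //; exact: subset_trans YX.
  - have nsat X : ~ satisfies X r.
      rewrite /satisfies h0 p0 n0 => -[//||l []//].
      by rewrite -subset0 => l [].
    by apply: valid_inert; [move=> X Y _ /nsat|exact: Or33].
  apply: valid_inert; last exact: Or31.
  move=> X Y YX satX nX0 pY.
  (* The body holds in [X], so a head literal lies in [X]: impossible if the head is empty or inside
     the negative body, which is disjoint from [X]. *)
  have [|//|l [/= hl Xl]] := satX; first exact: subset_trans YX.
  case: hr => [h0|/fsubsetP hn]; first by move: hl; rewrite h0.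
  have : ([set` rneg r] `&` X) l by split=> //; exact: hn.
  by rewrite nX0.
split=> // -[cpos coh]; split=> // vwr; apply: contrapT => ncond.
have [nT nC nC3] : [/\ ~ TAUT r, ~ CONTRA r & ~ CONSTR3 r].
  by split=> ?; apply: ncond; left; tauto.
have w0 := valid_weight_eq0 cpos nT nC nC3 vwr.
have [C2|[l [hl nl cl]]] := coh w0.
  by apply: ncond; right; split=> //; right.
exact: (not_valid_support nT nC hl nl cl vwr).
Qed.
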